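(* Every nested-triangle graph with $n=3k$ vertices ($k\geq 1$) has a non-aligned planar straight-line drawing in an $n\times\left(\frac{4}{3}n-1\right)$-grid.
   Context: A nested-triangle graph with $3k$ vertices ($k\geq1$) has vertex set $\{u_i,v_i,w_i: i=1,\dots,k\}$ and edges consisting of: the triangles $\{u_i,v_i,w_i\}$ for $i=1,\dots,k$; the paths $u_1u_2\cdots u_k$, $v_1v_2\cdots v_k$, $w_1w_2\cdots w_k$; and, optionally, in each 4-cycle of the form $u_iu_{i+1}v_{i+1}v_i$, $v_iv_{i+1}w_{i+1}w_i$ or $w_iw_{i+1}u_{i+1}u_i$ ($1\leq i<k$), at most one of its two diagonals (any choice). It is considered with the planar embedding in which the triangle $\{u_1,v_1,w_1\}$ is the outer face and triangle $\{u_{i+1},v_{i+1},w_{i+1}\}$ lies inside triangle $\{u_i,v_i,w_i\}$. A $W\times H$-grid is the set of integer points $(x,y)$ with $1\leq x\leq W$, $1\leq y\leq H$. A planar straight-line drawing maps vertices to distinct points and edges to straight segments with no crossings and no edge through a non-incident vertex. It is non-aligned if no two vertices share an $x$-coordinate and no two share a $y$-coordinate. *)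

(* Defs.v *)
From HB Require Import structures.
From mathcomp Require Import all_boot all_order all_algebra.
Set Implicit Arguments. Unset Strict Implicit. Unset Printing Implicit Defensive.
Import Order.TTheory GRing.Theory Num.Theory.

(* Vertices of the nested-triangle graph with 3k vertices:
   (i, c) with i : 'I_k the layer (0-based: layer i is triangle i+1 of the
   paper) and c : 'I_3 the colour: 0 = u, 1 = v, 2 = w. *)
Definition ntvert (k : nat) := ('I_k * 'I_3)%type.

(* Choice of diagonals.  [D i c] concerns the 4-cycle between layers i and
   i+1 formed by colours c and c' := (c+1) mod 3, i.e. for c = 0,1,2 the
   cycles u_i u_{i+1} v_{i+1} v_i, v_i v_{i+1} w_{i+1} w_i,
   w_i w_{i+1} u_{i+1} u_i.
     None        : no diagonal
     Some true   : diagonal  (i,c) -- (i+1,c')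
     Some false  : diagonal  (i,c') -- (i+1,c)                              *)
Definition diag_choice := nat -> 'I_3 -> option bool.

Definition diag_up k (D : diag_choice) (x y : ntvert k) : bool :=
  (val y.1 == (val x.1).+1) &&
  (((D (val x.1) x.2 == Some true) && (val y.2 == (val x.2).+1 %% 3)) ||
   ((D (val x.1) y.2 == Some false) && (val x.2 == (val y.2).+1 %% 3))).

Definition nt_adj k (D : diag_choice) (x y : ntvert k) : bool :=
  [|| (x.1 == y.1) && (x.2 != y.2),
      (x.2 == y.2) && ((val y.1 == (val x.1).+1) || (val x.1 == (val y.1).+1)),
      diag_up D x y | diag_up D y x ].

Local Open Scope ring_scope.

Definition pt := (rat * rat)%type.

Definition ptI (p : int * int) : pt := (p.1%:~R, p.2%:~R).

Definition on_seg (p a b : pt) : Prop :=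
  exists t : rat, 0 <= t <= 1 /\
    p = (a.1 + t * (b.1 - a.1), a.2 + t * (b.2 - a.2)).

Definition segs_meet (a b c d : pt) : Prop :=
  exists p : pt, on_seg p a b /\ on_seg p c d.

Definition strictly_inside (p a b c : pt) : Prop :=
  exists la lb lc : rat, [/\ 0 < la, 0 < lb, 0 < lc, la + lb + lc = 1 &
    p = (la * a.1 + lb * b.1 + lc * c.1, la * a.2 + lb * b.2 + lc * c.2)].

(* planar straight-line drawing of the graph (V, adj) with integer positions:
   distinct points, no edge passes through a non-incident vertex, and edges
   without common endpoint do not meet (edges sharing an endpoint can then
   only meet at it). *)
Definition planar_sl_drawing (V : finType) (adj : rel V) (pos : V -> int * int)
  : Prop :=
  [/\ injective pos,
      (forall a b c, adj a b -> c != a -> c != b ->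
         ~ on_seg (ptI (pos c)) (ptI (pos a)) (ptI (pos b))) &
      (forall a b c d, adj a b -> adj c d ->
         a != c -> a != d -> b != c -> b != d ->
         ~ segs_meet (ptI (pos a)) (ptI (pos b)) (ptI (pos c)) (ptI (pos d)))].

Definition non_aligned (V : finType) (pos : V -> int * int) : Prop :=
  forall a b, a != b -> (pos a).1 != (pos b).1 /\ (pos a).2 != (pos b).2.

Definition in_grid (V : finType) (W H : nat) (pos : V -> int * int) : Prop :=
  forall a, 1 <= (pos a).1 <= W%:Z /\ 1 <= (pos a).2 <= H%:Z.

(* the drawing respects the fixed nested embedding: every vertex of triangle
   i+1 lies strictly inside triangle i (so triangle 1 is the outer face) *)
Definition nested_drawing k (pos : ntvert k -> int * int) : Prop :=
  forall (i j : 'I_k) (c : 'I_3), val j = (val i).+1 ->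
    strictly_inside (ptI (pos (j, c))) (ptI (pos (i, 0))) (ptI (pos (i, 1)))
                    (ptI (pos (i, 2))).

(* Main.v *)
(* Layer [i] (0-based, outermost first) goes to u = (i+1, i+1),
   v = (3k-i, k+1+i), w = (k+1+i, 4k-1-2i), so each colour moves along a fixed
   direction and occupies its own block of columns and rows.  All quadrilaterals
   between consecutive triangles are then strictly convex, hence admit either
   diagonal, except the innermost one at v and w, where v_(k-2), v_(k-1), w_(k-1)
   are collinear; if the diagonal v_(k-2) w_(k-1) is required there, exchanging
   the roles of v and w turns it into the other, harmless one.

   Disjointness of edges is certified by separating lines: sides of triangles
   and the lines of the paths u, v, w. *)
Require Import Defs.
From HB Require Import structures.
From mathcomp Require Import all_boot all_order all_algebra.
From mathcomp Require Import perm.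
From mathcomp Require Import zify ring lra.
Set Implicit Arguments. Unset Strict Implicit. Unset Printing Implicit Defensive.
Import Order.TTheory GRing.Theory Num.Theory.
Local Open Scope ring_scope.

(** * Orientation of point triples and separation of segments by lines *)

(** Twice the signed area of the triangle [a b p], positive when [p] is to the left of the line from
    [a] to [b]. The ring is generic so that rational points on edges can be compared with integer
    vertices. *)
Definition orient (R : pzRingType) (a b p : R * R) : R :=
  (b.1 - a.1) * (p.2 - a.2) - (b.2 - a.2) * (p.1 - a.1).

Lemma orient_ptI (a b p : int * int) :
  orient (ptI a) (ptI b) (ptI p) = (orient a b p)%:~R.
Proof. by rewrite /orient /ptI /= !(rmorphB, rmorphM). Qed.

Lemma ptI_inj : injective ptI.
Proof. by move=> [a b] [c d] [/intr_inj-> /intr_inj->]. Qed.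

Lemma orient_swap (a b p : int * int) : orient b a p = - orient a b p.
Proof. rewrite /orient; ring. Qed.

Lemma on_seg_sym (p a b : pt) : on_seg p a b -> on_seg p b a.
Proof.
move=> [t [/andP[t0 t1] ->]]; exists (1 - t); split; first by lra.
by congr pair; ring.
Qed.

Lemma segs_meetC (a b c d : pt) : segs_meet a b c d -> segs_meet c d a b.
Proof. by move=> [p [? ?]]; exists p. Qed.

Lemma segs_meet_swapl (a b c d : pt) : segs_meet a b c d -> segs_meet b a c d.
Proof. by move=> [p [/on_seg_sym ? ?]]; exists p. Qed.

Lemma segs_meet_swapr (a b c d : pt) : segs_meet a b c d -> segs_meet a b d c.
Proof. by move=> [p [? /on_seg_sym ?]]; exists p. Qed.

Lemma on_seg_orient (u v p a b : pt) : on_seg p a b ->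
  exists t : rat, [/\ 0 <= t, t <= 1,
    orient u v p = (1 - t) * orient u v a + t * orient u v b &
    t = 1 -> p = b].
Proof.
move=> [t [/andP[t0 t1] ->]]; exists t; split=> //.
- by rewrite /orient /=; ring.
- by move=> ->; case: b => b1 b2; congr pair => /=; ring.
Qed.

Lemma on_seg_orient_ge0 (u v a b : int * int) (p : pt) :
  0 <= orient u v a -> 0 <= orient u v b -> on_seg p (ptI a) (ptI b) ->
  0 <= orient (ptI u) (ptI v) p.
Proof.
move=> ha hb /(on_seg_orient (ptI u) (ptI v))[t [t0 t1 -> _]].
rewrite !orient_ptI.
by apply: addr_ge0; apply: mulr_ge0; rewrite ?ler0z //; rewrite subr_ge0.
Qed.

(** Orientation is affine along the segment, so from a negative value at [a] it can climb to zero
    only at the far end. *)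
Lemma on_seg_orient_le0 (u v a b : int * int) (p : pt) :
  orient u v a < 0 -> orient u v b <= 0 -> on_seg p (ptI a) (ptI b) ->
  0 <= orient (ptI u) (ptI v) p -> p = ptI b /\ orient u v b = 0.
Proof.
move=> ha hb /(on_seg_orient (ptI u) (ptI v))[t [t0 t1 -> e1]].
rewrite !orient_ptI => h.
have ha' : (orient u v a)%:~R < 0 :> rat by rewrite ltrz0.
have hb' : (orient u v b)%:~R <= 0 :> rat by rewrite lerz0.
have t1E : t = 1 by nra.
split; first exact: e1.
by move: h; rewrite t1E subrr mul0r add0r mul1r ler0z => h; apply/le_anti/andP.
Qed.

Lemma separated (u v a b c d : int * int) :
  orient u v a < 0 -> orient u v b < 0 ->
  0 <= orient u v c -> 0 <= orient u v d ->
  ~ segs_meet (ptI a) (ptI b) (ptI c) (ptI d).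
Proof.
move=> ha hb hc hd [p [pab /(on_seg_orient_ge0 hc hd) h]].
by have [_ e] := on_seg_orient_le0 ha (ltW hb) pab h; rewrite e in hb.
Qed.

(** Each segment can touch the line only at one endpoint, [b] and [c] respectively, so a common
    point would be both. *)
Lemma weakly_separated (u v a b c d : int * int) :
  orient u v a < 0 -> orient u v b <= 0 ->
  0 <= orient u v c -> 0 < orient u v d -> b != c ->
  ~ segs_meet (ptI a) (ptI b) (ptI c) (ptI d).
Proof.
move=> ha hb hc hd nbc [p [pab pcd]].
have [pb b0] := on_seg_orient_le0 ha hb pab
  (on_seg_orient_ge0 hc (ltW hd) pcd).
have [] := @on_seg_orient_le0 v u d c p _ _ (on_seg_sym pcd).
- by rewrite orient_swap oppr_lt0.
- by rewrite orient_swap oppr_le0.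
- by rewrite pb orient_ptI orient_swap b0.
by move=> pc _; move: nbc; rewrite (ptI_inj (etrans (esym pb) pc)) eqxx.
Qed.

(* [c d] lies in the wedge with apex [b] cut out by the two lines, and [a] is
   beyond the first line. *)
Lemma wedge_separated (u v u' v' a b c d : int * int) :
  a = b \/ orient u v a < 0 ->
  orient u v b = 0 -> orient u' v' b = 0 ->
  0 <= orient u v c -> 0 <= orient u' v' c ->
  0 < orient u v c + orient u' v' c ->
  0 <= orient u v d -> 0 <= orient u' v' d ->
  0 < orient u v d + orient u' v' d ->
  ~ segs_meet (ptI a) (ptI b) (ptI c) (ptI d).
Proof.
move=> ha hb hb' c1 c2 c12 d1 d2 d12 [p [pab pcd]].
have pb : p = ptI b.
  case: ha => [eab|ha].
    move: pab; rewrite eab => -[t [_ ->]].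
    by rewrite !subrr !mulr0 !addr0; case: (ptI b).
  have [] // := on_seg_orient_le0 ha _ pab (on_seg_orient_ge0 c1 d1 pcd).
  by rewrite hb.
move: pcd => [r [/andP[r0 r1] pE]].
(* The sum of the two orientations is affine along [c d] and positive at both ends, yet it would
   vanish at the apex [b]. *)
have e1 : orient (ptI u) (ptI v) p + orient (ptI u') (ptI v') p
  = (1 - r) * ((orient u v c)%:~R + (orient u' v' c)%:~R)
    + r * ((orient u v d)%:~R + (orient u' v' d)%:~R).
  by rewrite -!orient_ptI pE /orient /=; ring.
move: e1; rewrite pb !orient_ptI hb hb' addr0 => e1.
move: c12; rewrite -(ltr0z rat) intrD => c12.
move: d12; rewrite -(ltr0z rat) intrD => d12.
suff : 0 < 0 :> rat by rewrite ltxx.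
(* One of the weights [r] and [1 - r] is at least one half; its term is strictly positive. *)
rewrite [X in _ < X]e1; have [r12|r12] := lerP r (1 / 2).
  by rewrite ltr_wpDr ?mulr_ge0 ?mulr_gt0 ?(ltW d12) //; lra.
by rewrite ltr_wpDl ?mulr_ge0 ?mulr_gt0 ?(ltW c12) //; lra.
Qed.

(** The barycentric coordinates of [p] are area ratios: the triangles that [p] spans with the three
    sides add up to [a b c]. *)
Lemma strictly_inside_orient (a b c p : int * int) :
  0 < orient a b p -> 0 < orient b c p -> 0 < orient c a p ->
  strictly_inside (ptI p) (ptI a) (ptI b) (ptI c).
Proof.
move=> h1 h2 h3.
have e : orient a b c = orient a b p + orient b c p + orient c a p.
  by rewrite /orient; ring.
have h : 0 < (orient a b c)%:~R :> rat.
  by rewrite ltr0z e; apply: addr_gt0 => //; apply: addr_gt0.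
have nz : (orient a b c)%:~R != 0 :> rat by rewrite gt_eqF.
exists ((orient b c p)%:~R / (orient a b c)%:~R),
       ((orient c a p)%:~R / (orient a b c)%:~R),
       ((orient a b p)%:~R / (orient a b c)%:~R).
split; try by apply: divr_gt0; rewrite // ltr0z.
all: move: nz; rewrite -!orient_ptI.
all: case: (ptI a) (ptI b) (ptI c) (ptI p) => a1 a2 [b1 b2] [c1 c2] [p1 p2].
all: rewrite /orient /= => nz.
  by field.
by congr pair; field.
Qed.

Lemma strictly_inside_swap (p a b c : pt) :
  strictly_inside p a b c -> strictly_inside p a c b.
Proof.
move=> [x [y [z [hx hy hz s ->]]]]; exists x, z, y.
by split=> //; [rewrite -s|congr pair]; ring.
Qed.

(** * Cyclic order of the colours and coordinates of the layers *)

Definition cyc (c d : 'I_3) : bool := val d == ((val c).+1 %% 3)%N.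

Lemma cyc_total (c d : 'I_3) : c != d -> cyc c d || cyc d c.
Proof. by case: c d => [[|[|[|?]]] ?] // [[|[|[|?]]] ?]. Qed.

Lemma cyc_next (c : 'I_3) : exists d, cyc c d.
Proof.
by case: c => [[|[|[|?]]] ?] //;
  [exists (@Ordinal 3 1 isT)|exists (@Ordinal 3 2 isT)|exists (@Ordinal 3 0 isT)].
Qed.

Lemma cyc_prev (c : 'I_3) : exists d, cyc d c.
Proof.
by case: c => [[|[|[|?]]] ?] //;
  [exists (@Ordinal 3 2 isT)|exists (@Ordinal 3 0 isT)|exists (@Ordinal 3 1 isT)].
Qed.

Definition vpos (k m : nat) (c : 'I_3) : int * int :=
  match val c with
  | 0%N => (m%:Z + 1, m%:Z + 1)
  | 1%N => (3 * k%:Z - m%:Z, k%:Z + 1 + m%:Z)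
  | _ => (k%:Z + 1 + m%:Z, 4 * k%:Z - 1 - 2 * m%:Z)
  end.

(** Colours run counterclockwise, so left of a side means inside. Both the nesting and all
    separations by sides rest on this. *)
Lemma side_gt0 k m n (c d e : 'I_3) : cyc c d -> (m <= n)%N -> (n < k)%N ->
  (n, e) != (m, c) -> (n, e) != (m, d) ->
  0 < orient (vpos k m c) (vpos k m d) (vpos k n e).
Proof.
(* Substituting [n = s + m] and [k = t + n.+1] turns the order hypotheses into nonnegativity of [s]
   and [t], a form suited to [nia]. *)
move=> + /subnK <-; move: (n - m)%N => s + /subnK <-.
move: (k - _)%N => t.
rewrite !xpair_eqE.
case: c d e => [[|[|[|?]]] ?] // [[|[|[|?]]] ?] // [[|[|[|?]]] ?] // _;
rewrite /vpos /orient /= -?val_eqE /= ?andbT ?andbF ?orbT //; nia.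
Qed.

(** From left to right the blocks of columns belong to u, w, v; from bottom to top the blocks of
    rows belong to u, v, w. *)
Lemma vpos_neq k m n (c d : 'I_3) : (m < k)%N -> (n < k)%N -> (m, c) != (n, d) ->
  (vpos k m c).1 != (vpos k n d).1 /\ (vpos k m c).2 != (vpos k n d).2.
Proof.
rewrite !xpair_eqE.
case: c d => [[|[|[|?]]] ?] // [[|[|[|?]]] ?] //;
rewrite /vpos /= -?val_eqE /= ?andbT ?andbF ?orbT //; lia.
Qed.

(** * Lines of the paths, and sides of a triangle seen from the layer outside it *)

(** Together with the two [spoke_next] lemmas, this makes the line of one path separate the other
    two colours, as needed for two edges joining the same pair of layers. *)
Lemma spoke_prev k m n (c d : 'I_3) : cyc d c -> (m.+1 < k)%N ->
  n = m \/ n = m.+1 ->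
  orient (vpos k m.+1 c) (vpos k m c) (vpos k n d) < 0.
Proof.
move=> + /subnK <-; move: (k - _)%N => t.
case: c d => [[|[|[|?]]] ?] // [[|[|[|?]]] ?] // _ [] ->;
rewrite /vpos /orient /=; nia.
Qed.

Lemma spoke_next_outer k m (c d : 'I_3) : cyc c d -> (m.+1 < k)%N ->
  0 < orient (vpos k m.+1 c) (vpos k m c) (vpos k m d).
Proof.
move=> + /subnK <-; move: (k - _)%N => t.
case: c d => [[|[|[|?]]] ?] // [[|[|[|?]]] ?] // _;
rewrite /vpos /orient /=; nia.
Qed.

(* Equality is the collinearity of the two innermost v with the innermost w. *)
Lemma spoke_next_inner k m (c d : 'I_3) : cyc c d -> (m.+1 < k)%N ->
  0 <= orient (vpos k m.+1 c) (vpos k m c) (vpos k m.+1 d)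
    ?= iff (m.+2 == k) && (val c == 1%N).
Proof.
move=> + /subnK <-; move: (k - _)%N => t.
case: c d => [[|[|[|?]]] ?] // [[|[|[|?]]] ?] // _;
rewrite /vpos /orient /= ?andbT ?andbF; split; nia.
Qed.

(** With [side_outer_start], this is convexity of the quadrilateral at its inner side: edges reach
    the inner triangle from beyond that side. *)
Lemma side_outer_end k m (c d : 'I_3) : cyc c d -> (m.+1 < k)%N ->
  orient (vpos k m.+1 c) (vpos k m.+1 d) (vpos k m d) < 0.
Proof.
move=> + /subnK <-; move: (k - _)%N => t.
case: c d => [[|[|[|?]]] ?] // [[|[|[|?]]] ?] // _;
rewrite /vpos /orient /=; nia.
Qed.

Lemma side_outer_start k m (c d : 'I_3) : cyc c d -> (m.+1 < k)%N ->
  (m.+2 != k) || (val c != 1%N) ->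
  orient (vpos k m.+1 c) (vpos k m.+1 d) (vpos k m c) < 0.
Proof.
move=> + /subnK <-; move: (k - _)%N => t.
case: c d => [[|[|[|?]]] ?] // [[|[|[|?]]] ?] // _;
rewrite /vpos /orient /= ?orbT ?orbF => ?; nia.
Qed.

Lemma orientl (a b : int * int) : orient a b a = 0.
Proof. rewrite /orient; ring. Qed.

Lemma orientr (a b : int * int) : orient a b b = 0.
Proof. rewrite /orient; ring. Qed.

Lemma cyc_neq (c d : 'I_3) : cyc c d -> c != d.
Proof. by case: c d => [[|[|[|?]]] ?] // [[|[|[|?]]] ?]. Qed.

Lemma side_ge0 k m n (c d e : 'I_3) : cyc c d -> (m <= n)%N -> (n < k)%N ->
  0 <= orient (vpos k m c) (vpos k m d) (vpos k n e).
Proof.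
move=> cd mn nk; have [[-> ->]|h1] := eqVneq (n, e) (m, c).
  by rewrite orientl.
have [[-> ->]|h2] := eqVneq (n, e) (m, d); first by rewrite orientr.
exact/ltW/side_gt0.
Qed.

(** The two sides at corner [c] have only [c] in common, so at any other vertex one of the two
    orientations is positive. The sum is the form [wedge_separated] takes. *)
Lemma corner_gt0 k m n (c d e f : 'I_3) : cyc e c -> cyc c d ->
  (m <= n)%N -> (n < k)%N -> (n, f) != (m, c) ->
  0 < orient (vpos k m c) (vpos k m d) (vpos k n f) +
      orient (vpos k m e) (vpos k m c) (vpos k n f).
Proof.
move=> ec cd mn nk h; have mk := leq_ltn_trans mn nk.
have [[-> ->]|hd] := eqVneq (n, f) (m, d).
  rewrite orientr add0r; apply: side_gt0 => //; rewrite xpair_eqE eqxx /=.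
    by case: c d e ec cd {h} =>
      [[|[|[|?]]] ?] // [[|[|[|?]]] ?] // [[|[|[|?]]] ?].
  by rewrite eq_sym cyc_neq.
by rewrite ltr_pwDl ?side_gt0 ?side_ge0.
Qed.

(** * Disjointness of edges, by the layers they join *)

(* [cr m c d]: colour [c] of layer [m] is joined to colour [d] of layer [m.+1].
   [cr_last] forbids the diagonal from v_(k-2) to w_(k-1). *)
Section Drawing.
Variables (k : nat) (cr : nat -> 'I_3 -> 'I_3 -> bool).
Hypothesis cr_anti : forall m c d, cr m c d -> cr m d c -> c = d.
Hypothesis cr_last : forall m (c d : 'I_3),
  cr m c d -> cyc c d -> (m.+2 != k) || (val c != 1%N).

Local Notation P := (vpos k).
Local Notation meet m c m' c' n d n' d' :=
  (segs_meet (ptI (P m c)) (ptI (P m' c')) (ptI (P n d)) (ptI (P n' d'))).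

(** A vertex is treated as a degenerate edge, so that vertex-edge and edge-edge disjointness share
    one form. *)
Lemma apart_vertex m n n' (c d d' : 'I_3) :
  (m <= n)%N -> (m <= n')%N -> (n < k)%N -> (n' < k)%N ->
  (n, d) != (m, c) -> (n', d') != (m, c) -> ~ meet m c m c n d n' d'.
Proof.
move=> mn mn' nk n'k h h'.
have [e ec] := cyc_prev c; have [f cf] := cyc_next c.
apply: (@wedge_separated (P m c) (P m f) (P m e) (P m c));
  rewrite ?side_ge0 ?corner_gt0 ?orientl ?orientr //; by left.
Qed.

Lemma apart_side m n n' (c c' d d' : 'I_3) : c != c' ->
  (m <= n)%N -> (m <= n')%N -> (n < k)%N -> (n' < k)%N ->
  (n, d) != (m, c) -> (n', d') != (m, c) ->
  (n, d) != (m, c') -> (n', d') != (m, c') -> ~ meet m c m c' n d n' d'.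
Proof.
wlog cc : c c' / cyc c c'.
  move=> H ncc; have /orP[h|h] := cyc_total ncc; first exact: H.
  move=> ? ? ? ? ? ? ? ? /segs_meet_swapl; apply: H => //.
  by rewrite eq_sym.
move=> _ mn mn' nk n'k h1 h2 h3 h4 /segs_meetC.
by apply: (@separated (P m c') (P m c));
  rewrite orient_swap ?oppr_lt0 ?side_gt0 ?orientl ?orientr ?oppr0.
Qed.

(** The wedge is the corner [c'] of triangle [m.+1]. In each case a side at that corner is chosen
    that has the outer endpoint strictly beyond it. *)
Lemma apart_cross_inner m n n' (c c' d d' : 'I_3) : cr m c c' ->
  (m < n)%N -> (m < n')%N -> (n < k)%N -> (n' < k)%N ->
  (n, d) != (m.+1, c') -> (n', d') != (m.+1, c') -> ~ meet m c m.+1 c' n d n' d'.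
Proof.
move=> ccr mn mn' nk n'k h h'; have mk : (m.+1 < k)%N by exact: leq_ltn_trans nk.
have [e ec] := cyc_prev c'; have [f cf] := cyc_next c'.
have [cc|ncc] := boolP (cyc c c').
  apply: (@wedge_separated (P m.+1 c) (P m.+1 c') (P m.+1 c') (P m.+1 f));
    rewrite ?orientl ?orientr ?side_ge0 // 1?addrC ?corner_gt0 //.
  by right; apply: side_outer_start => //; exact: cr_last ccr cc.
have [->|nc] := eqVneq c c'.
  apply: (@wedge_separated (P m.+1 e) (P m.+1 c') (P m.+1 c') (P m.+1 f));
    rewrite ?orientl ?orientr ?side_ge0 // 1?addrC ?corner_gt0 //.
  by right; exact: side_outer_end.
have c'c : cyc c' c by have := cyc_total nc; rewrite (negbTE ncc).
apply: (@wedge_separated (P m.+1 c') (P m.+1 c) (P m.+1 e) (P m.+1 c'));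
  rewrite ?orientl ?orientr ?side_ge0 ?corner_gt0 //.
by right; exact: side_outer_end.
Qed.

Lemma vpos_inj m n (c d : 'I_3) : (m < k)%N -> (n < k)%N ->
  (m, c) != (n, d) -> P m c != P n d.
Proof.
by move=> mk nk h; apply: contraNneq (proj1 (vpos_neq mk nk h)) => ->.
Qed.

(** With [d] following [c], the path line of [d] separates the edges, unless the first one leads to
    the third colour [e]; then the path line of [c] does. Two diagonals of one quadrilateral are
    excluded by [cr_anti]. *)
Lemma apart_cross_cross m (c c' d d' : 'I_3) : (m.+1 < k)%N ->
  cr m c c' -> cr m d d' -> c != d -> c' != d' ->
  ~ meet m c m.+1 c' m d m.+1 d'.
Proof.
move=> mk; wlog cd : c c' d d' / cyc c d.
  move=> H h h' nc nc'; have /orP[cd|dc] := cyc_total nc; first exact: H.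
  by move/segs_meetC; apply: H => //; rewrite eq_sym.
move=> ec ed ncd nc'; have [e ec'] := cyc_prev c.
have de : cyc d e.
  by case: c d e cd ec' {ec ed ncd} => [[|[|[|?]]] ?] // [[|[|[|?]]] ?] // [[|[|[|?]]] ?].
have cases (x : 'I_3) : [|| x == c, x == d | x == e].
  by case: c d e x cd ec' {ec ed ncd de} =>
    [[|[|[|?]]] ?] // [[|[|[|?]]] ?] // [[|[|[|?]]] ?] // [[|[|[|?]]] ?].
have mk' := ltnW mk.
have S0 n x : n = m \/ n = m.+1 -> orient (P m.+1 x) (P m x) (P n x) = 0.
  by case=> ->; rewrite ?orientl ?orientr.
have SI x y : cyc x y -> 0 <= orient (P m.+1 x) (P m x) (P m.+1 y).
  by move=> xy; have [] := spoke_next_inner xy mk.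
have := cases c'; case/or3P=> /eqP E; subst c'.
- have := cases d'; case/or3P=> /eqP E; subst d'; first by rewrite eqxx in nc'.
    by apply: (@separated (P m.+1 d) (P m d));
      rewrite ?spoke_prev ?orientl ?orientr //; [left|right].
  by apply: (@separated (P m.+1 d) (P m d));
    rewrite ?spoke_prev ?orientl ?orientr ?SI //; [left|right].
- have := cases d'; case/or3P=> /eqP E; subst d'.
  + by have e0 := cr_anti ec ed; rewrite e0 eqxx in ncd.
  + by rewrite eqxx in nc'.
  apply: (@weakly_separated (P m.+1 d) (P m d));
    rewrite ?spoke_prev ?orientl ?orientr //; first by left.
    (* Strictness fails only in the collinear innermost case, where [cr_last] forbids the diagonal
       from [d] to [e]. *)
    have [g q] := spoke_next_inner de mk.
    rewrite lt_neqAle g andbT q.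
    by have := cr_last ed de; case: (_ == k); case: (_ == 1%N).
  by rewrite vpos_inj // xpair_eqE eqn_leq ltnn.
- have d'c : (d' == c) || (d' == d).
    by have := cases d'; rewrite [d' == e]eq_sym (negbTE nc') !orbF.
  move/segs_meet_swapl/segs_meet_swapr.
  apply: (@weakly_separated (P m.+1 c) (P m c));
    rewrite ?spoke_prev ?orientl ?orientr ?spoke_next_outer //; first by right.
    by case/orP: d'c => /eqP ->; rewrite ?orientl ?SI.
  by rewrite vpos_inj // xpair_eqE eqn_leq ltnn andbF.
Qed.

Definition inward (x y : nat * 'I_3) : bool :=
  (x.1 == y.1) && (x.2 != y.2) || (y.1 == x.1.+1) && cr x.1 x.2 y.2.

Lemma apart (x y z t : nat * 'I_3) :
  (x == y) || inward x y -> (z == t) || inward z t ->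
  (y.1 < k)%N -> (t.1 < k)%N -> x != z -> x != t -> y != z -> y != t ->
  ~ meet x.1 x.2 y.1 y.2 z.1 z.2 t.1 t.2.
Proof.
wlog xz : x y z t / (x.1 <= z.1)%N.
  move=> H hx hz yk tk xz xt yz yt.
  have [h|/ltnW h] := leqP x.1 z.1; first exact: H.
  by move/segs_meetC; apply: H; rewrite // eq_sym.
case: x y z t xz => [m c] [m' c'] [n d] [n' d'] /= mn.
rewrite /inward /= => hx hz m'k n'k xz xt yz yt.
have nn' : (n <= n')%N.
  by case/orP: hz => [/eqP[->]|/orP[/andP[/eqP->]|/andP[/eqP->]]].
have nk := leq_ltn_trans nn' n'k; have mn' := leq_trans mn nn'.
case/orP: hx => [/eqP[? ?]|/orP[/andP[/eqP ? nc]|/andP[/eqP ? cc']]];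
  try subst m'; try subst c'.
- by apply: apart_vertex; rewrite // eq_sym.
- by apply: apart_side; rewrite // eq_sym.
move: mn; rewrite leq_eqVlt => /orP[/eqP ?|mn]; last first.
  by apply: apart_cross_inner; rewrite ?(leq_trans mn nn') // eq_sym.
subst n; have mk := ltnW m'k.
case/orP: hz => [/eqP[? ?]|/orP[/andP[/eqP ? nc]|/andP[/eqP ? dd']]];
  try subst n'; try subst d'.
- by move/segs_meetC; apply: apart_vertex.
- by move/segs_meetC; apply: apart_side.
apply: apart_cross_cross => //.
- by apply: contraNneq xz => ->.
- by apply: contraNneq yt => ->.
Qed.

End Drawing.

(** * Edges of the graph between layers, and the exchange of v and w *)

Definition dcross (D : diag_choice) (m : nat) (c d : 'I_3) : bool :=
  [|| c == d, (D m c == Some true) && cyc c d | (D m d == Some false) && cyc d c].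

Lemma dcross_anti D m (c d : 'I_3) : dcross D m c d -> dcross D m d c -> c = d.
Proof.
rewrite /dcross (eq_sym d); case: eqVneq => //= _.
(* With three colours only one of [c], [d] follows the other, so both diagonals would give a single
   entry of [D] two values. *)
have : ~~ (cyc c d && cyc d c) by case: c d => [[|[|[|?]]] ?] // [[|[|[|?]]] ?].
by case: (cyc c d); case: (cyc d c); rewrite ?andbF ?andbT ?orbF //= => _ /eqP ->.
Qed.

Lemma nt_adj_inward k (D : diag_choice) (x y : ntvert k) : nt_adj D x y ->
  let f (v : ntvert k) := (val v.1, v.2) in
  inward (dcross D) (f x) (f y) || inward (dcross D) (f y) (f x).
Proof.
case: x y => [i c] [j d]; rewrite /nt_adj /diag_up /inward /dcross /cyc /=.
case/or4P=> [/andP[/eqP -> cd]|/andP[/eqP -> /orP[]->]|/andP[-> h]|/andP[-> h]].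
- by rewrite eqxx cd.
- by rewrite eqxx !orbT.
- by rewrite eqxx !orbT.
- by rewrite h !orbT.
- by rewrite h !orbT.
Qed.

Lemma inward_map (cr cr' : nat -> 'I_3 -> 'I_3 -> bool) (s : 'I_3 -> 'I_3) x y :
  injective s -> (forall m c d, cr m c d -> cr' m (s c) (s d)) ->
  inward cr x y -> inward cr' (x.1, s x.2) (y.1, s y.2).
Proof.
move=> sI crE; rewrite /inward /= (inj_eq sI).
by case/orP=> [->//|/andP[-> /crE ->]]; rewrite orbT.
Qed.

Lemma colour_choice k (D : diag_choice) : exists s : 'I_3 -> 'I_3,
  [/\ involutive s, (s =1 id \/ [/\ s 0 = 0, s 1 = 2 & s 2 = 1]) &
    forall m (c d : 'I_3), dcross D m (s c) (s d) -> cyc c d ->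
      (m.+2 != k) || (val c != 1%N)].
Proof.
(* For [k = 1] the truncated [k.-2] is 0, but then no [m] satisfies [m.+2 = k], so either branch is
   sound. *)
have [h|h] := boolP (dcross D k.-2 1 2).
  exists (tperm (1 : 'I_3) 2); split; first exact: tpermK.
    by right; rewrite tpermL tpermR tpermD.
  move=> m c d hd; have [mk|//] := eqVneq m.+2 k.
  have [c1|//] := eqVneq (val c) 1%N; rewrite /cyc c1 => /eqP d2.
  have cE : c = 1 by apply: val_inj; rewrite c1.
  have dE : d = 2 by apply: val_inj; rewrite d2.
  move: hd h; rewrite -mk cE dE tpermL tpermR => hd h.
  by have := dcross_anti hd h.
exists id; split=> //; first by left.
move=> m c d hd; have [mk|//] := eqVneq m.+2 k.
have [c1|//] := eqVneq (val c) 1%N; rewrite /cyc c1 => /eqP d2.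
have cE : c = 1 by apply: val_inj; rewrite c1.
have dE : d = 2 by apply: val_inj; rewrite d2.
by move: hd h; rewrite -mk cE dE => ->.
Qed.

(* Assembling the drawing *)
Local Close Scope ring_scope.

Theorem theorem5 (k : nat) (D : diag_choice) : 1 <= k ->
  exists pos : ntvert k -> int * int,
    [/\ planar_sl_drawing (nt_adj D) pos,
        nested_drawing pos,
        non_aligned pos &
        in_grid (3 * k) (4 * k - 1) pos].
Proof.
move=> k_gt0; have [s [sK sE hlast]] := colour_choice k D.
have sI := inv_inj sK.
(* Edges are recoloured by the position they are drawn at; [s] is its own inverse, so the same map
   serves both directions. *)
pose cr m c d := dcross D m (s c) (s d).
have anti m c d : cr m c d -> cr m d c -> c = d.
  by move=> h h'; apply/sI/(dcross_anti h h').
pose f (v : ntvert k) := (val v.1, s v.2).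
have fI : injective f by move=> [i c] [j d] [/val_inj -> /sI ->].
pose pos (v : ntvert k) := vpos k (val v.1) (s v.2).
have na : non_aligned pos.
  move=> a b ab; apply: vpos_neq; rewrite ?ltn_ord //.
  by apply: contraNneq ab => /(fI a b)->.
have adjE x y : nt_adj D x y -> inward cr (f x) (f y) || inward cr (f y) (f x).
  have mapE := @inward_map (dcross D) cr s _ _ sI.
  move/nt_adj_inward/orP=> [] /mapE h; rewrite h ?orbT //;
    by move=> m c d; rewrite /cr !sK.
have key a b c d : inward cr (f a) (f b) -> (c == d) || inward cr (f c) (f d) ->
    a != c -> a != d -> b != c -> b != d ->
    ~ segs_meet (ptI (pos a)) (ptI (pos b)) (ptI (pos c)) (ptI (pos d)).
  move=> ab cd ac ad bc bd; apply: (apart anti hlast (x := f a) (y := f b)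
    (z := f c) (t := f d)); rewrite ?(inj_eq fI) ?ltn_ord //.
  by rewrite ab orbT.
have meet0 a b c d : nt_adj D a b -> (c == d) || nt_adj D c d ->
    a != c -> a != d -> b != c -> b != d ->
    ~ segs_meet (ptI (pos a)) (ptI (pos b)) (ptI (pos c)) (ptI (pos d)).
  move=> ab cd ac ad bc bd.
  have key' x y : inward cr (f x) (f y) -> x != c -> x != d -> y != c -> y != d ->
      ~ segs_meet (ptI (pos x)) (ptI (pos y)) (ptI (pos c)) (ptI (pos d)).
    case/orP: cd => [cd|/adjE/orP[cd|cd]] xy *.
    - by apply: key; rewrite ?cd.
    - by apply: key; rewrite ?cd ?orbT.
    - by move/segs_meet_swapr; apply: key; rewrite ?cd ?orbT.
  case/orP: (adjE _ _ ab) => h; first exact: key'.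
  by move/segs_meet_swapl; apply: key'.
exists pos; split=> //.
- split.
  + by move=> a b ab; apply/eqP; apply: contraT => /na[/eqP]; rewrite ab.
  (* A vertex on an edge is a meeting with the degenerate segment from [c] to [c]. *)
  + move=> a b c ab ca cb pc; apply: (meet0 a b c c);
      rewrite ?eqxx // 1?eq_sym // 1?eq_sym //.
    exists (ptI (pos c)); split=> //; exists 0%R; split=> //.
    by rewrite !mul0r !addr0; case: (ptI _).
  + by move=> a b c d ab cd; apply: meet0; rewrite // cd orbT.
- move=> i j c ij.
  have H d e : cyc d e -> 
      (0 < orient (vpos k (val i) d) (vpos k (val i) e) (pos (j, c)))%R.
    move=> de; apply: side_gt0; rewrite ?ltn_ord ?ij // xpair_eqE;
      by rewrite eqn_leq ltnn.
  have h : strictly_inside (ptI (pos (j, c))) (ptI (vpos k (val i) 0%R))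
      (ptI (vpos k (val i) 1%R)) (ptI (vpos k (val i) 2%R)).
    by apply: strictly_inside_orient; apply: H.
  case: sE => [sid|[s0 s1 s2]]; rewrite /pos /=.
    by rewrite (sid 0%R) (sid 1%R) (sid 2%R).
  by rewrite s0 s1 s2; apply: strictly_inside_swap.
- move=> [i c]; rewrite /pos /=; move: (s c) (ltn_ord i) => {}c ik.
  by case: c => [[|[|[|?]]] ?] //; rewrite /vpos /=; lia.
Qed.
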